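(* Let $T>1$, $0<\alpha<1$ and $f\in C^1([1,T])$ be real-valued. (i) If $f$ attains its maximum value over $[1,T]$ at a point $t_0\in(1,T]$, then $$D_*^{\alpha}f(t_0)\ \ge\ \frac{1}{\Gamma(1-\alpha)}(\log t_0)^{-\alpha}\bigl(f(t_0)-f(1)\bigr)\ \ge\ 0 .$$ (ii) If $f$ attains its minimum value over $[1,T]$ at a point $t_0\in(1,T]$, then $$D_*^{\alpha}f(t_0)\ \le\ \frac{1}{\Gamma(1-\alpha)}(\log t_0)^{-\alpha}\bigl(f(t_0)-f(1)\bigr)\ \le\ 0 .$$
   Context: The Hadamard-type fractional derivative of order $\alpha\in(0,1)$ with base point $1$ is $$D_*^{\alpha}f(t)=\frac{1}{\Gamma(1-\alpha)}\int_1^t\left(\log\frac{t}{s}\right)^{-\alpha}f'(s)\,ds,$$ where $\Gamma$ is the Euler gamma function. *)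

(* Defs.v *)
From HB Require Import structures.
From mathcomp Require Import all_boot all_order all_algebra.
From mathcomp Require Import all_classical all_reals all_analysis.
Set Implicit Arguments.
Unset Strict Implicit.
Unset Printing Implicit Defensive.
Import Order.TTheory GRing.Theory Num.Theory.
Import numFieldNormedType.Exports.
Local Open Scope classical_set_scope.
Local Open Scope ring_scope.

(* The difference quotient at [x] is taken along points of [a, b] only, so that
   the derivative is two-sided in the interior and one-sided at [a] and [b];
   nothing is required of [f] outside [a, b]. *)
Definition C1_on (R : realType) (a b : R) (f : R -> R) : Prop :=
  exists df : R -> R,
    (forall x : R, x \in `[a, b] ->
       (f y - f x) / (y - x) @[y --> within `[a, b] x^'] --> df x) /\
    {within `[a, b], continuous df}.

Definition Gamma (R : realType) (z : R) : R :=
  \int[lebesgue_measure]_(x in `]0, +oo[) (x `^ (z - 1) * expR (- x)).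

(* The integral is over the open interval because [f^`()] is the two-sided
   derivative, which a function of class C^1 on [1, T] need not have at the
   endpoints; this does not affect the (Lebesgue) integral. *)
Definition hadamard_deriv (R : realType) (alpha : R) (f : R -> R) (t : R) : R :=
  (Gamma (1 - alpha))^-1 *
  \int[lebesgue_measure]_(s in `]1, t[) (ln (t / s) `^ (- alpha) * (f^`()%classic) s).

(* Main.v *)
Require Import Defs.
From HB Require Import structures.
From mathcomp Require Import all_boot all_order all_algebra.
From mathcomp Require Import all_classical all_reals all_analysis.
From mathcomp Require Import measurable_realfun ring lra.
Import Order.TTheory GRing.Theory Num.Theory.
Import numFieldNormedType.Exports.
Local Open Scope classical_set_scope.
Local Open Scope ring_scope.

(** Write [K s := ln (t / s) `^ (- alpha)] for the kernel. The proof compares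
    the singular integral of [K * f'] over [1, t] with the one in which the
    weight [K] is replaced by its value at the base point. Consider
      [Phi u := \int_1^u K f' + K u * (f t - f u)].
    By the fundamental theorem of calculus the two terms in [K u * f' u] cancel
    and [Phi' u = K' u * (f t - f u)], which is nonnegative when [f] is maximal
    at [t], since [K] increases for [alpha > 0]. Hence [Phi 1 <= Phi t]. Here
    [Phi 1 = K 1 * (f t - f 1)] is the lower bound wanted, and [Phi t] is the
    integral, because the boundary term [K u * (f t - f u)] vanishes as [u]
    tends to [t]: it is the difference quotient of [f] at [t], which stays
    bounded, times [(t - u) * K u], which is at most
    [t * ln (t / u) `^ (1 - alpha)].

    Two analytic facts make this rigorous: [K * f'] is integrable up to the
    singularity ([integrable_powR_ln_div_mul]), so that [Phi] is continuous on
    the closed interval, and the boundary term tends to [0]. Both rest on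
    [alpha < 1]. Monotonicity of [Phi] is [powR_ln_div_mul_le_integral].

    The statement on minima follows by applying the one on maxima to [- f], and
    the signs of the two bounds follow from [Gamma >= 0] and extremality. *)

(** * From one-sided difference quotients to derivatives *)

Section SlopeLimits.
Context {R : realType}.
Variables (a b : R) (f : R -> R) (x l : R).
Hypothesis fl : (f y - f x) / (y - x) @[y --> within `[a, b] x^'] --> l.

Lemma slope_cvg_is_derive : x \in `]a, b[ -> is_derive x 1 f l.
Proof.
rewrite in_itv/= => /andP[ax xb].
suff fxl : h^-1 *: ((f \o shift x) (h *: 1) - f x) @[h --> 0^'] --> l.
  by split; [apply/cvg_ex; exists l | exact/cvg_lim].
apply/cvgrPdist_lt => e e0.
move/cvgrPdist_lt : fl => /(_ _ e0); rewrite near_withinE.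
move=> [d /= d0 Hd].
near=> h.
have h0 : h != 0 by near: h; exact: nbhs_dnbhs_neq.
have hd : `|h| < d by near: h; exact: dnbhs0_lt.
have ha : `|h| < x - a by near: h; apply: dnbhs0_lt; rewrite subr_gt0.
have hb : `|h| < b - x by near: h; apply: dnbhs0_lt; rewrite subr_gt0.
have := Hd (h + x); rewrite /= in_itv/= -[h *: 1]/(h * 1) mulr1 addrK.
rewrite [_ *: _]mulrC; apply.
- by rewrite opprD addrC subrK normrN.
- by rewrite -subr_eq0 addrK.
- by move: ha hb; rewrite !ltr_norml => /andP[? ?] /andP[? ?]; apply/andP; lra.
Unshelve. all: end_near. Qed.

Lemma slope_cvg_continuous : f y @[y --> within `[a, b] (nbhs x)] --> f x.
Proof.
have H : f x + (f y - f x) / (y - x) * (y - x) @[y --> within `[a, b] x^'] --> f x.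
  rewrite -[X in _ --> X]addr0 -[X in _ --> _ + X](mulr0 l).
  apply: cvgD; first exact: cvg_cst.
  apply: cvgM => //.
  have : y - x @[y --> x] --> 0.
    by rewrite -(subrr x); apply: cvgB; [exact: cvg_id | exact: cvg_cst].
  apply: cvg_trans; apply: cvg_app.
  by apply: cvg_trans; [exact: cvg_within | exact: cvg_within].
apply/cvgrPdist_lt => e e0.
move/cvgrPdist_lt : H => /(_ _ e0); rewrite !near_withinE.
move=> [d /= d0 Hd]; exists d => //= y xy yab.
have [->|yx] := eqVneq y x; first by rewrite subrr normr0.
by have := Hd y xy yx yab; rewrite divfK ?subr_eq0// addrCA subrr addr0.
Qed.

End SlopeLimits.

(** * Integrability from a bounded primitive *)

Section ImproperIntegral.
Context {R : realType}.
Local Notation mu := (@lebesgue_measure R).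

(** On [a, b - 1/(n+1)] the integral of [g] is an increment of [F], hence at
    most [M - F a]; monotone convergence carries this bound to [a, b[. Since
    only the bound on [F] survives the limit, [g] may blow up at [b]. *)
Lemma integrable_ge0_derive (F g : R -> R) (a b : R) : a < b ->
  {in `[a, b[, forall x, 0 <= g x} ->
  {in `[a, b[, continuous g} ->
  {in `[a, b[, forall x : R, is_derive x 1 F (g x)} ->
  (exists M, {in `[a, b[, forall x, F x <= M}) ->
  mu.-integrable `[a, b] (EFin \o g).
Proof.
move=> ab g0 cg dF [M FM].
have wg A : A `<=` `[a, b[ -> {within A, continuous g}.
  by move=> Aab; apply: continuous_in_subspaceT => x /set_mem /Aab; exact: cg.
have cF : {in `[a, b[, continuous F}.
  move=> x xab; apply/differentiable_continuous/derivable1_diffP.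
  by apply: ex_derive; exact: dF.
have mg : measurable_fun `[a, b[ g.
  by apply: subspace_continuous_measurable_fun => //; exact: wg.
have mg' : measurable_fun `[a, b] g.
  exact/measurable_fun_itv_bndo_bndcP.
apply/integrableP; split; first exact/measurable_EFinP.
rewrite -integral_itv_bndo_bndc; last first.
  by do 2 apply: measurableT_comp => //.
rewrite (_ : (\int[mu]_(x in _) _ = \int[mu]_(x in `[a, b[) (g x)%:E)%E); last first.
  by apply: eq_integral => x /set_mem xab /=; rewrite ger0_norm// g0.
have sub n : `[a, b - n.+1%:R^-1] `<=` `[a, b[.
  by apply: subset_itvl; rewrite bnd_simp ltrBlDr ltrDl invr_gt0.
have cvgg : (\int[mu]_(x in `[a, (b - n.+1%:R^-1)%R]) (g x)%:E @[n --> \oo] -->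
    \int[mu]_(x in `[a, b[) (g x)%:E)%E.
  rewrite itv_bnd_open_bigcup.
  apply: ge0_nondecreasing_set_cvg_integral => //.
  - move=> n m nm; rewrite subsetEset; apply: subset_itvl.
    by rewrite bnd_simp lerB// lef_pV2 ?posrE// ler_nat.
  - by move=> n; apply/measurable_EFinP; apply: measurable_funS (mg).
  - by move=> n x /sub xab; rewrite lee_fin g0.
move/cvg_lim : (cvgg) => <-//.
apply: (@le_lt_trans _ _ (M - F a)%:E); last exact: ltry.
apply: lime_le; first by apply/cvg_ex; eexists; exact: cvgg.
apply: nearW => n.
have [abn|abn] := ltP a (b - n.+1%:R^-1); last first.
  (* For small [n] the interval is empty or a point. *)
  apply: (@le_trans _ _ 0%E); last first.
    by rewrite lee_fin subr_ge0 FM// in_itv/= lexx.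
  rewrite le_eqVlt; apply/orP; left; apply/eqP.
  move: abn; rewrite le_eqVlt => /predU1P[->|abn].
    by rewrite set_itv1 integral_set1.
  by rewrite set_itv_ge ?integral_set0// bnd_simp -ltNge.
have inn x : x \in `[a, b - n.+1%:R^-1] -> x \in `[a, b[ by exact: sub.
rewrite (continuous_FTC2 (F := F) abn).
- by rewrite -EFinB lee_fin lerB// FM// inn// in_itv/= lexx ltW.
- exact/wg/sub.
- split.
  + move=> x xab; apply: ex_derive; apply: dF; apply: inn.
    exact: subset_itv_oo_cc.
  + by apply: cvg_at_right_filter; apply: cF; rewrite in_itv/= lexx.
  + apply: cvg_at_left_filter; apply: cF; apply: inn.
    by rewrite in_itv/= lexx ltW.
- move=> x xab; rewrite derive1E; apply: derive_val; apply: dF; apply: inn.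
  exact: subset_itv_oo_cc.
Qed.

End ImproperIntegral.

(** * The logarithmic kernel *)

Section HadamardKernel.
Context {R : realType}.
Variable t : R.
Hypothesis t0 : 0 < t.

Lemma ln_div_gt0 (s : R) : s \in `]0, t[ -> 0 < ln (t / s).
Proof.
by rewrite in_itv/= => /andP[s0 st]; rewrite ln_gt0// ltr_pdivlMr// mul1r.
Qed.

Lemma is_derive_powR_ln_div (p s : R) : s \in `]0, t[ ->
  is_derive s 1 (fun u => ln (t / u) `^ p) (- p * ln (t / s) `^ (p - 1) / s).
Proof.
move=> st; have L0 := ln_div_gt0 _ st.
have s0 : 0 < s by move: st; rewrite in_itv/= => /andP[].
have dV : is_derive s 1 (fun u : R => u^-1) (- s ^- 2 *: (1 : R)).
  by apply: is_deriveV; rewrite gt_eqF.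
have ds : is_derive s 1 (fun u : R => t / u) (t *: (- s ^- 2 *: (1 : R))).
  exact: is_deriveZ.
have ts0 : 0 < t / s by rewrite divr_gt0.
have dL := @is_derive1_comp _ (@ln R) (fun u => t / u) _ _ _ (is_derive1_ln ts0) ds.
have dP := @is_derive1_comp _ (@powR R ^~ p) (fun u => ln (t / u)) _ _ _
  (is_derive1_powR p L0) dL.
apply: (is_derive_eq dP); rewrite /GRing.scale/=.
by field; rewrite !gt_eqF.
Qed.

Lemma cvg_powR_ln_div (p : R) : 0 < p ->
  ln (t / s) `^ p @[s --> t^'-] --> 0.
Proof.
move=> p0.
apply: (@decreasing_cvg_at_left_comp _ (fun s => ln (t / s)) (@powR R ^~ p)
  (BRight 0) t).
- by rewrite bnd_simp.
- move=> x y; rewrite !in_itv/= => /andP[x0 _] /andP[y0 _] xy.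
  by rewrite ltr_ln ?posrE ?divr_gt0// ltr_pM2l// ltf_pV2.
- apply: cvg_at_left_filter.
  have tt0 : 0 < t / t by rewrite divr_gt0.
  apply: (@cvg_comp _ _ _ (fun s => t / s) (@ln R) (nbhs t) (nbhs (t / t)));
    last exact: continuous_ln.
  apply: cvgM; first exact: cvg_cst.
  by apply: cvgV; [rewrite gt_eqF | exact: cvg_id].
- by rewrite divff ?gt_eqF// ln1; exact: powR_cvg0.
Qed.

(** The inequality [ln x <= x - 1] at [x = s / t]. It lets a factor
    [t - s] absorb one power of [ln (t / s)] near [t]. *)
Lemma sub_le_mul_ln_div (s : R) : 0 < s -> t - s <= t * ln (t / s).
Proof.
move=> s0.
have : ln (1 + (s / t - 1)) <= s / t - 1.
  by rewrite le_ln1Dx// ltrBrDr addrC subrr divr_gt0.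
rewrite addrC subrK -[s / t]invf_div lnV ?posrE ?divr_gt0// => H.
have := ler_wpM2l (ltW t0) H; rewrite invf_div mulrBr mulr1 mulrN mulrCA divff ?gt_eqF//.
lra.
Qed.

End HadamardKernel.

(** * Integrals weighted by the kernel *)

Section WeightedIntegral.
Context {R : realType}.
Local Notation mu := (@lebesgue_measure R).
Variables (a t alpha : R).
Hypotheses (a0 : 0 < a) (at_ : a < t) (alpha0 : 0 < alpha) (alpha1 : alpha < 1).

Let t0 : 0 < t. Proof. exact: lt_trans at_. Qed.

Let kernel (s : R) : R := ln (t / s) `^ (- alpha).

Let in0t (s : R) : s \in `[a, t[ -> s \in `]0, t[.
Proof.
by rewrite !in_itv/= => /andP[as_ ->]; rewrite (lt_le_trans a0).
Qed.

Let continuous_kernel : {in `[a, t[, continuous kernel}.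
Proof.
move=> s /in0t st; apply/differentiable_continuous/derivable1_diffP.
by apply: ex_derive; exact: is_derive_powR_ln_div.
Qed.

Let measurable_kernel : measurable_fun `[a, t] kernel.
Proof.
apply/measurable_fun_itv_bndo_bndcP.
apply: subspace_continuous_measurable_fun => //.
by apply: continuous_in_subspaceT => s /set_mem; exact: continuous_kernel.
Qed.

(** On [a, t] the kernel is at most [t / s] times itself, and this product has
    the explicit primitive [- t / (1 - alpha) * ln (t / s) `^ (1 - alpha)],
    which is bounded above by [0]. *)
Lemma integrable_powR_ln_div : mu.-integrable `[a, t] (EFin \o kernel).
Proof.
have alpha1' : 1 - alpha != 0 by rewrite subr_eq0 gt_eqF.
refine (@le_integrable _ _ _ mu _ _ (EFin \o kernel)
  (EFin \o (fun s => t / s * kernel s)) _ _ _) => //.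
- exact/measurable_EFinP.
- move=> s /=; rewrite in_itv/= => /andP[as_ st].
  have s0 : 0 < s by exact: lt_le_trans as_.
  rewrite lee_fin !ger0_norm ?mulr_ge0 ?powR_ge0 ?invr_ge0 ?(ltW s0) ?(ltW t0)//.
  by rewrite ler_peMl ?powR_ge0// ler_pdivlMr// mul1r.
apply: (@integrable_ge0_derive _
  (fun s => - t / (1 - alpha) * ln (t / s) `^ (1 - alpha))
  (fun s => t / s * kernel s) a t) => //.
- move=> s /in0t; rewrite in_itv/= => /andP[s0 st].
  by rewrite mulr_ge0 ?powR_ge0// divr_ge0// ltW.
- move=> s sat; apply: cvgM; last exact: continuous_kernel.
  apply: cvgM; first exact: cvg_cst.
  apply: cvgV; last exact: cvg_id.
  by have := in0t _ sat; rewrite in_itv/= => /andP[s0 _]; rewrite gt_eqF.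
- move=> s /in0t st.
  have s0 : s != 0 by move: st; rewrite in_itv/= => /andP[s0 _]; rewrite gt_eqF.
  refine (is_derive_eq (is_deriveZ (- t / (1 - alpha))
    (is_derive_powR_ln_div _ t0 (1 - alpha) _ st)) _).
  rewrite /kernel /GRing.scale/=.
  rewrite (_ : 1 - alpha - 1 = - alpha); last by ring.
  by field; rewrite s0.
- exists 0 => s _; rewrite mulNr mulNr oppr_le0 mulr_ge0 ?powR_ge0//.
  by rewrite divr_ge0 ?(ltW t0)// subr_ge0 ltW.
Qed.

Variables (f df : R -> R).
Hypothesis cf : {within `[a, t], continuous f}.
Hypothesis cdf : {within `[a, t], continuous df}.
Hypothesis f_derive : {in `]a, t[, forall x : R, is_derive x 1 f (df x)}.

Lemma integrable_powR_ln_div_mul :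
  mu.-integrable `[a, t] (EFin \o (fun s => ln (t / s) `^ (- alpha) * df s)).
Proof.
apply: (@integrableMl _ _ _ mu _ _ (EFin \o kernel) df) => //.
- exact: integrable_powR_ln_div.
- exact: subspace_continuous_measurable_fun.
- have := @compact_bounded _ _ _ (continuous_compact cdf (@segment_compact _ a t)).
  move=> [M [Mreal HM]]; exists M; split => // x Mx y yat.
  by apply: (HM x Mx); exists y.
Qed.

Hypothesis slope_t : (f u - f t) / (u - t) @[u --> t^'-] --> df t.

(** [K u * (f t - f u)] is the product of the difference quotient of [f] at [t]
    and [(t - u) * K u], and the latter is squeezed between [0] and
    [t * ln (t / u) `^ (1 - alpha)]. *)
Let boundary_term_cvg : kernel u * (f t - f u) @[u --> t^'-] --> 0.
Proof.
have Kcvg : (t - u) * kernel u @[u --> t^'-] --> 0.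
  apply: (@squeeze_cvgr _ _ _ _ (fun=> 0) (fun u => t * ln (t / u) `^ (1 - alpha))).
  - near=> u.
    have ua : a < u by near: u; exact: nbhs_left_gt.
    have ut : u < t by near: u; exact: nbhs_left_lt.
    have u0 : 0 < u by exact: lt_trans ua.
    have L0 : 0 < ln (t / u) by apply: ln_div_gt0; rewrite in_itv/= u0.
    rewrite mulr_ge0 ?powR_ge0 ?subr_ge0 ?(ltW ut)//=.
    rewrite powRD; last by rewrite (gt_eqF L0) implybT.
    by rewrite powRr1 ?(ltW L0)// mulrA ler_wpM2r ?powR_ge0// sub_le_mul_ln_div.
  - exact: cvg_cst.
  - rewrite -[X in _ --> X](mulr0 t); apply: cvgM; first exact: cvg_cst.
    by apply: cvg_powR_ln_div; rewrite ?subr_gt0.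
rewrite -[X in _ --> X](mulr0 (df t)).
apply: cvg_trans (cvgM slope_t Kcvg); apply: near_eq_cvg; near=> u.
have ut : u < t by near: u; exact: nbhs_left_lt.
by rewrite /=; field; rewrite subr_eq0 lt_eqF.
Unshelve. all: end_near. Qed.

(** The weight increases and the remaining increment [f t - f u] is nonnegative,
    so that replacing the weight by its value at [a] can only decrease the
    integral. This is an integration by parts in disguise: differentiating
    [Phi] avoids integrating the derivative of the kernel, which is more
    singular at [t] than the kernel itself. *)
Lemma powR_ln_div_mul_le_integral : {in `[a, t], forall s, f s <= f t} ->
  ln (t / a) `^ (- alpha) * (f t - f a) <=
  \int[mu]_(s in `[a, t]) (ln (t / s) `^ (- alpha) * df s).
Proof.
move=> fmax.
have [cfoo cfa _] := (continuous_within_itvP f at_).1 cf.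
have [cdfoo _ _] := (continuous_within_itvP df at_).1 cdf.
have inco (s : R) : s \in `]a, t[ -> s \in `[a, t[.
  by rewrite !in_itv/= => /andP[/ltW -> ->].
pose I (u : R) := \int[mu]_(s in `[a, u]) (ln (t / s) `^ (- alpha) * df s).
pose Phi (u : R) := I u + kernel u * (f t - f u).
have I_derive x : x \in `]a, t[ -> is_derive x 1 I (kernel x * df x).
  move=> xat; have /andP[ax xt] : a < x < t by move: xat; rewrite in_itv.
  have cx : {for x, continuous (fun s : R => ln (t / s) `^ (- alpha) * df s)}.
    by apply: cvgM; [exact/continuous_kernel/inco | exact: cdfoo].
  have [dI I'] := continuous_FTC1_closed xt integrable_powR_ln_div_mul ax cx.
  by split => //; rewrite -derive1E.
have Phi_derive x : x \in `]a, t[ -> is_derive x 1 Phi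
    (alpha * ln (t / x) `^ (- alpha - 1) / x * (f t - f x)).
  move=> xat.
  have dK := is_derive_powR_ln_div _ t0 (- alpha) _ (in0t _ (inco _ xat)).
  have dh : is_derive x 1 (fun u => f t - f u) (0 - df x).
    by apply: is_deriveB; exact: f_derive.
  apply: (is_derive_eq (is_deriveD (I_derive _ xat) (is_deriveM dK dh))).
  by rewrite /kernel /GRing.scale/=; ring.
have cPhi : {within `[a, t], continuous Phi}.
  have cI := parameterized_integral_continuous (ltW at_) integrable_powR_ln_div_mul.
  apply: (@within_continuousD _ _ _ _ _ _ cI).
  apply/(continuous_within_itvP _ at_); split.
  - move=> x xat; apply: cvgM; first exact/continuous_kernel/inco.
    by apply: cvgB; [exact: cvg_cst | exact: cfoo].
  - apply: cvgM; last by apply: cvgB; [exact: cvg_cst | exact: cfa].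
    by apply: cvg_at_right_filter; apply: continuous_kernel; rewrite in_itv/= lexx.
  - by rewrite subrr mulr0; exact: boundary_term_cvg.
have : Phi a <= Phi t.
  apply: (@ger0_derive1_le_cc _ Phi a t) => //.
  - by move=> x xat; apply: ex_derive; exact: Phi_derive.
  - move=> x xat; rewrite derive1E (@derive_val _ _ _ _ _ _ _ (Phi_derive _ xat)).
    move: xat; rewrite in_itv/= => /andP[ax xt].
    rewrite !mulr_ge0 ?powR_ge0 ?invr_ge0 ?(ltW alpha0) ?subr_ge0//.
      by rewrite (ltW (lt_trans a0 ax)).
    by rewrite fmax// in_itv/= !ltW.
  - by rewrite in_itv/= lexx ltW.
  - by rewrite in_itv/= lexx ltW.
  - exact: ltW.
by rewrite /Phi /I set_itv1 Rintegral_set1 add0r subrr mulr0 addr0.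
Qed.

End WeightedIntegral.

(** * The Hadamard derivative at an extremum *)

Section HadamardDerivative.
Context {R : realType}.
Local Notation mu := (@lebesgue_measure R).

Lemma C1_on_opp (a b : R) (f : R -> R) : C1_on a b f -> C1_on a b (- f).
Proof.
move=> [df [slope cdf]]; exists (- df); split; last first.
  by move=> x; apply: cvgN; exact: cdf.
move=> x /slope /cvgN; apply: cvg_trans; apply: near_eq_cvg.
by near=> y; rewrite /= -mulNr opprB opprK addrC.
Unshelve. all: end_near. Qed.

(** Differentiability at [t] is given as a left limit to cover [t = b], where
    [f] need not have a two-sided derivative. *)
Lemma C1_on_prefix (a b t : R) (f : R -> R) : C1_on a b f -> t \in `]a, b] ->
  exists df : R -> R,
    [/\ {within `[a, t], continuous f}, {within `[a, t], continuous df},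
        {in `]a, t[, forall x : R, is_derive x 1 f (df x)} &
        (f u - f t) / (u - t) @[u --> t^'-] --> df t].
Proof.
move=> [df [slope cdf]]; rewrite in_itv/= => /andP[at_ tb].
have sub : `[a, t] `<=` `[a, b] by apply: subset_itvl; rewrite bnd_simp.
exists df; split.
- apply: (continuous_subspaceW sub); apply/subspace_continuousP => x xab.
  exact: slope_cvg_continuous (slope x xab).
- exact: continuous_subspaceW cdf.
- move=> x xt; have xab : x \in `]a, b[.
    by move: xt; rewrite !in_itv/= => /andP[-> /lt_le_trans]; exact.
  exact: slope_cvg_is_derive (slope x (subset_itv_oo_cc xab)) xab.
- have /slope : t \in `[a, b] by rewrite in_itv/= ltW.
  apply: cvg_trans; apply: cvg_app => A [d /= d0 dA].
  exists (Num.min d (t - a)); first by rewrite /= lt_min d0 subr_gt0.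
  move=> u /=; rewrite lt_min => /andP[ud uta] ut.
  apply: dA => //=; first by rewrite lt_eqF.
  by move: uta; rewrite gtr0_norm ?subr_gt0// in_itv/=; lra.
Qed.

Variables (T alpha t : R) (f : R -> R).
Hypotheses (alpha0 : 0 < alpha) (alpha1 : alpha < 1).
Hypotheses (f_C1 : C1_on 1 T f) (tT : t \in `]1, T]).

Let t1 : 1 < t. Proof. by move: tT; rewrite in_itv/= => /andP[]. Qed.

Let Rintegral_derive1 (df : R -> R) :
  {in `]1, t[, forall x : R, is_derive x 1 f (df x)} ->
  {in `]1, t[, (fun s => ln (t / s) `^ (- alpha) * f^`()%classic s) =1
               (fun s => ln (t / s) `^ (- alpha) * df s)}.
Proof.
move=> f_derive x xt; congr (_ * _); rewrite derive1E.
by apply: derive_val; exact: f_derive.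
Qed.

(** Allows the sign to be taken out of the integral in [hadamard_derivN]. *)
Lemma integrable_hadamard : mu.-integrable `]1, t[
  (EFin \o (fun s => ln (t / s) `^ (- alpha) * f^`()%classic s)).
Proof.
have [df [_ cdf f_derive _]] := C1_on_prefix _ _ _ _ f_C1 tT.
have := integrable_powR_ln_div_mul _ _ _ ltr01 t1 alpha1 _ cdf.
move/(@integrableS _ _ _ mu _ `]1, t[).
have /[swap]/[apply] : `]1, t[ `<=` `[1, t] by exact: subset_itv_oo_cc.
move=> /(_ (measurable_itv _) (measurable_itv _)).
apply: eq_integrable => // x /set_mem xt /=.
by rewrite (Rintegral_derive1 _ f_derive).
Qed.

Lemma hadamard_derivN : hadamard_deriv alpha (- f) t = - hadamard_deriv alpha f t.
Proof.
have [df [_ _ f_derive _]] := C1_on_prefix _ _ _ _ f_C1 tT.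
rewrite /hadamard_deriv -mulrN -[X in _ = _ * X]mulN1r; congr (_ * _).
rewrite -RintegralZl//; last exact: integrable_hadamard.
apply: eq_Rintegral => x /set_mem xt; rewrite mulN1r -mulrN; congr (_ * _).
by rewrite !derive1E deriveN//; apply: ex_derive; exact: f_derive.
Qed.

Lemma inv_Gamma_ge0 (z : R) : 0 <= (Gamma z)^-1.
Proof.
rewrite invr_ge0; apply: Rintegral_ge0 => x _.
by rewrite mulr_ge0 ?powR_ge0 ?expR_ge0.
Qed.

Lemma hadamard_deriv_ge_at_max : {in `[1, T], forall x, f x <= f t} ->
  (Gamma (1 - alpha))^-1 * ln t `^ (- alpha) * (f t - f 1) <=
  hadamard_deriv alpha f t.
Proof.
move=> fmax.
have [df [cf cdf f_derive slope_t]] := C1_on_prefix _ _ _ _ f_C1 tT.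
have fmaxt : {in `[1, t], forall s, f s <= f t}.
  move=> s st; apply: fmax; move: st tT; rewrite !in_itv/=.
  by move=> /andP[-> /le_trans st] /andP[_ /st].
have H := powR_ln_div_mul_le_integral _ _ _ ltr01 t1 alpha0 alpha1 _ _ cf cdf
  f_derive slope_t fmaxt.
rewrite divr1 in H.
rewrite /hadamard_deriv -mulrA ler_wpM2l ?inv_Gamma_ge0//.
apply: (le_trans H); rewrite le_eqVlt; apply/orP; left; apply/eqP.
have intg := integrable_powR_ln_div_mul _ _ _ ltr01 t1 alpha1 _ cdf.
rewrite -Rintegral_itv_obnd_cbnd; last first.
  by apply: integrableS intg => //; apply: subset_itvr; rewrite bnd_simp.
rewrite -Rintegral_itv_bndo_bndc; last first.
  by apply: integrableS intg => //; apply: subset_itv; rewrite bnd_simp.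
by apply: eq_Rintegral => x /set_mem xt; rewrite (Rintegral_derive1 _ f_derive).
Qed.

End HadamardDerivative.

Theorem proposition3p1 (R : realType) (T alpha : R) (f : R -> R)
    (hT : 1 < T) (halpha0 : 0 < alpha) (halpha1 : alpha < 1)
    (hf : C1_on 1 T f) :
  (forall t0 : R, t0 \in `]1, T] ->
     (forall x : R, x \in `[1, T] -> f x <= f t0) ->
     hadamard_deriv alpha f t0 >=
       (Gamma (1 - alpha))^-1 * ln t0 `^ (- alpha) * (f t0 - f 1) /\
     (Gamma (1 - alpha))^-1 * ln t0 `^ (- alpha) * (f t0 - f 1) >= 0) /\
  (forall t0 : R, t0 \in `]1, T] ->
     (forall x : R, x \in `[1, T] -> f t0 <= f x) ->
     hadamard_deriv alpha f t0 <=
       (Gamma (1 - alpha))^-1 * ln t0 `^ (- alpha) * (f t0 - f 1) /\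
     (Gamma (1 - alpha))^-1 * ln t0 `^ (- alpha) * (f t0 - f 1) <= 0).
Proof.
have in1T : 1 \in `[1, T] by rewrite in_itv/= lexx ltW.
have weight_ge0 s : 0 <= (Gamma (1 - alpha))^-1 * ln s `^ (- alpha).
  by rewrite mulr_ge0 ?inv_Gamma_ge0 ?powR_ge0.
split=> t0 t0T fext; split.
- exact: (hadamard_deriv_ge_at_max T).
- by rewrite mulr_ge0// subr_ge0 fext.
- have := @hadamard_deriv_ge_at_max _ T alpha t0 (- f) halpha0 halpha1
    (C1_on_opp _ _ _ hf) t0T.
  rewrite (hadamard_derivN _ _ _ _ halpha1 hf t0T) => H.
  rewrite -lerN2 -mulrN opprB -[f 1]opprK [- - f 1 + _]addrC.
  by apply: H => x xT; rewrite lerN2 fext.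
- by rewrite mulr_ge0_le0// subr_le0 fext.
Qed.
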